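(* The running time of Algorithm OMSLR is $O(kn^2)$: there is an absolute constant $C$ such that for all integers $n,k,d\ge1$ with $kd\le n$ and every real sequence $X_n=(x_1,\dots,x_n)$, Algorithm OMSLR on input $X_n$ and $k$ (the number of non-overlapping segments, with minimum segment size $d$) performs at most $C\,k\,n^2$ elementary operations.
   Context: Elementary operations are real arithmetic operations, comparisons of reals, and reads/writes of table entries, each of unit cost (real-RAM model). **Regression error.** For $1\le a<b\le n$ put $\bar t_{ab}=\frac{a+b}{2}$, $\bar x_{ab}=\frac{1}{b-a+1}\sum_{m=a}^b x_m$, $\beta_{ab}=\frac{\sum_{m=a}^{b}(x_m-\bar x_{ab})(m-\bar t_{ab})}{\sum_{m=a}^{b}(m-\bar t_{ab})^2}$, $\alpha_{ab}=\bar x_{ab}-\beta_{ab}\bar t_{ab}$, and $\sigma^2(a,b)=\sum_{m=a}^{b}(x_m-\beta_{ab}m-\alpha_{ab})^2$; set $\sigma^2(a,a)=0$. **Algorithm OMSLR.** The integer $d\ge 1$ is the minimum allowed segment size. 1. Compute the table $\sigma^2(a,b)$ for all $1\le a\le b\le n$ iteratively: for each $a$, let $b$ run from $a$ to $n$, updating running sums (over $m$ from $a$ to $b$) of $x_m$, $m\,x_m$, $x_m^2$, $m$, $m^2$ and evaluating $\sigma^2(a,b)$ from these sums. 2. For $d\le j\le n$ set $\gamma_{1,j}=1$ and $\rho^2_{1,j}=\sigma^2(1,j)$. For $i=2,\dots,k$ and each $j$ with $id\le j\le n$, find by exhaustive search a minimizer $m^*$ of $\rho^2_{i-1,m}+\sigma^2(m+1,j)$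 over integers $(i-1)d\le m\le j-d$, and set $\gamma_{i,j}=m^*+1$ and $\rho^2_{i,j}=\rho^2_{i-1,\gamma_{i,j}-1}+\sigma^2(\gamma_{i,j},j)$. 3. Backtrack: $\hat l_k=n$, $\hat l_{k-1}=\gamma_{k,n}$, and $\hat l_{m}=\gamma_{m+1,\hat l_{m+1}-1}$ for $m=k-2,\dots,0$. Output the partition $(\hat l_0,\dots,\hat l_k)$ of $\{1,\dots,n\}$ into the $k$ intervals $[\hat l_{m-1},\hat l_m-1]$ ($1\le m\le k-1$) and $[\hat l_{k-1},\hat l_k]$, and the value $\rho^2_{k,n}$. *)

(* Defs.v *)
From HB Require Import structures.
From mathcomp Require Import all_boot all_order all_algebra.
From mathcomp Require Import ring lra.

Set Implicit Arguments.
Unset Strict Implicit.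
Unset Printing Implicit Defensive.

Import Order.TTheory GRing.Theory Num.Theory.

Local Open Scope ring_scope.

(** ** Regression error of x_a, ..., x_b (the sequence is indexed from 1) *)

Section RegressionError.
Variables (R : realFieldType) (x : nat -> R).

Definition tbar (a b : nat) : R := (a + b)%:R / 2.

Definition xbar (a b : nat) : R :=
  (b - a + 1)%:R^-1 * \sum_(a <= m < b.+1) x m.

Definition beta (a b : nat) : R :=
  (\sum_(a <= m < b.+1) (x m - xbar a b) * (m%:R - tbar a b))
  / (\sum_(a <= m < b.+1) (m%:R - tbar a b) ^+ 2).

Definition alpha (a b : nat) : R := xbar a b - beta a b * tbar a b.

Definition sigma2 (a b : nat) : R :=
  if a == b then 0
  else \sum_(a <= m < b.+1) (x m - beta a b * m%:R - alpha a b) ^+ 2.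

End RegressionError.

(** ** Real-RAM programs *)

(* The cells of the tables: the input x_m, sigma^2(a,b) and rho^2_{i,j} hold
   reals; gamma_{i,j} and the breakpoints l_m hold indices. *)
Inductive rcell :=
  | XCell of nat
  | SigmaCell of nat & nat
  | RhoCell of nat & nat.

Inductive icell :=
  | GammaCell of nat & nat
  | LCell of nat.

Definition rcell_eqb (c c' : rcell) : bool :=
  match c, c' with
  | XCell m, XCell m' => m == m'
  | SigmaCell a b, SigmaCell a' b' => (a == a') && (b == b')
  | RhoCell i j, RhoCell i' j' => (i == i') && (j == j')
  | _, _ => false
  end.

Definition icell_eqb (c c' : icell) : bool :=
  match c, c' with
  | GammaCell i j, GammaCell i' j' => (i == i') && (j == j')
  | LCell m, LCell m' => m == m'
  | _, _ => false
  end.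

(* The elementary operations.  [V] is the type of real values; programs are
   polymorphic in it, so that these are the only means they have of computing
   with, comparing and storing reals.  [OpNat m] produces the integer m as a
   real and is charged as a real operation.  Loop control and arithmetic on
   indices are not elementary operations. *)
Inductive op (V : Type) : Type -> Type :=
  | OpNat of nat : op V V
  | OpAdd of V & V : op V V
  | OpSub of V & V : op V V
  | OpMul of V & V : op V V
  | OpDiv of V & V : op V V
  | OpLt of V & V : op V bool
  | OpLe of V & V : op V bool
  | OpReadR of rcell : op V V
  | OpWriteR of rcell & V : op V unit
  | OpReadI of icell : op V nat
  | OpWriteI of icell & nat : op V unit.

Inductive prog (V A : Type) : Type :=
  | Ret of A
  | Do (B : Type) of op V B & (B -> prog V A).

Arguments Ret {V A} _.
Arguments Do {V A B} _ _.
Arguments OpNat {V} _.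
Arguments OpReadR {V} _.
Arguments OpReadI {V} _.
Arguments OpWriteI {V} _ _.

Fixpoint bind (V A B : Type) (p : prog V A) (f : A -> prog V B) : prog V B :=
  match p with
  | Ret a => f a
  | Do _ o q => Do o (fun b => bind (q b) f)
  end.

Definition perform (V B : Type) (o : op V B) : prog V B := Do o (fun b => Ret b).
Coercion perform : op >-> prog.

Notation "'let*' x ':=' p 'in' q" := (bind p (fun x => q))
  (at level 200, x name, p at level 100, q at level 200,
   format "'[v' 'let*'  x  ':='  p  'in' '/' q ']'").

Fixpoint for_fold (V S : Type) (r : seq nat) (body : nat -> S -> prog V S)
    (s : S) : prog V S :=
  match r with
  | [::] => Ret s
  | i :: r' => let* s' := body i s in for_fold r' body s'
  end.

Definition for_each (V : Type) (r : seq nat) (body : nat -> prog V unit) :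
    prog V unit :=
  for_fold r (fun i _ => body i) tt.

(* The integers a, a + 1, ..., b (none if b < a). *)
Definition range (a b : nat) : seq nat := index_iota a b.+1.

(** ** Semantics and cost *)

Record store (R : Type) := Store { rmem : rcell -> R; imem : icell -> nat }.

Section Semantics.
Variable R : realFieldType.

Definition exec (B : Type) (o : op R B) (s : store R) : B * store R :=
  match o in op _ T return T * store R with
  | OpNat m => (m%:R, s)
  | OpAdd u v => (u + v, s)
  | OpSub u v => (u - v, s)
  | OpMul u v => (u * v, s)
  | OpDiv u v => (u / v, s)
  | OpLt u v => (u < v, s)
  | OpLe u v => (u <= v, s)
  | OpReadR c => (rmem s c, s)
  | OpWriteR c v =>
      (tt, Store (fun c' => if rcell_eqb c c' then v else rmem s c') (imem s))
  | OpReadI c => (imem s c, s)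
  | OpWriteI c i =>
      (tt, Store (rmem s) (fun c' => if icell_eqb c c' then i else imem s c'))
  end.

Record outcome (A : Type) :=
  Outcome { result : A; final : store R; op_count : nat }.

Fixpoint run (A : Type) (p : prog R A) (s : store R) : outcome A :=
  match p with
  | Ret a => Outcome a s 0
  | Do _ o q =>
      let bs := exec o s in
      let r := run (q bs.1) bs.2 in
      Outcome (result r) (final r) (op_count r).+1
  end.

Definition input_store (n : nat) (x : n.-tuple R) : store R :=
  Store (fun c => if c is XCell m then
                    if m is m'.+1 then x`_m' else 0
                  else 0)
        (fun _ => 0%N).

End Semantics.

(** ** Algorithm OMSLR *)

Section OMSLR.
Variable V : Type.

(* Running sums over m of x_m, m x_m, x_m^2, m and m^2. *)
Record sums := Sums { s_x : V; s_mx : V; s_xx : V; s_m : V; s_mm : V }.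

Definition zero_sums : prog V sums :=
  let* z := OpNat 0 in Ret (Sums z z z z z).

Definition update_sums (m : nat) (s : sums) : prog V sums :=
  let* xm := OpReadR (XCell m) in
  let* t := OpNat m in
  let* mx := OpMul t xm in
  let* xx := OpMul xm xm in
  let* mm := OpMul t t in
  let* sx := OpAdd (s_x s) xm in
  let* smx := OpAdd (s_mx s) mx in
  let* sxx := OpAdd (s_xx s) xx in
  let* sm := OpAdd (s_m s) t in
  let* smm := OpAdd (s_mm s) mm in
  Ret (Sums sx smx sxx sm smm).

(* The least-squares residual is orthogonal to the constants and to m, hence
   sum (x_m - beta m - alpha)^2
     = sum x_m^2 - beta sum m x_m - alpha sum x_m;
   see [eval_sigma2_correct]. *)
Definition eval_sigma2 (a b : nat) (s : sums) : prog V V :=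
  if a == b then perform (OpNat 0)
  else
    let* len := OpNat (b - a + 1) in
    let* xb := OpDiv (s_x s) len in
    let* tb := OpDiv (s_m s) len in
    let* u := OpMul (s_x s) tb in
    let* num := OpSub (s_mx s) u in
    let* v := OpMul (s_m s) tb in
    let* den := OpSub (s_mm s) v in
    let* be := OpDiv num den in
    let* w := OpMul be tb in
    let* al := OpSub xb w in
    let* y := OpMul be (s_mx s) in
    let* z := OpMul al (s_x s) in
    let* r := OpSub (s_xx s) y in
    OpSub r z.

Definition sigma_table (n : nat) : prog V unit :=
  for_each (range 1 n) (fun a =>
    let* s0 := zero_sums in
    let* _ := for_fold (range a n) (fun b s =>
      let* s' := update_sums b s in
      let* e := eval_sigma2 a b s' in
      let* _ := OpWriteR (SigmaCell a b) e in
      Ret s') s0 in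
    Ret tt).

Definition candidate (i j m : nat) : prog V V :=
  let* r := OpReadR (RhoCell i.-1 m) in
  let* e := OpReadR (SigmaCell m.+1 j) in
  OpAdd r e.

(* Exhaustive search over (i-1)d <= m <= j - d.  The pair carried along is the
   best m so far with its value.  [tie i j m] tells whether m replaces an
   earlier index of equal value; as [tie] varies, every minimizer is reached. *)
Definition search (tie : nat -> nat -> nat -> bool) (d i j : nat) :
    prog V nat :=
  let m0 := (i.-1 * d)%N in
  let* v0 := candidate i j m0 in
  let* best := for_fold (range m0.+1 (j - d)) (fun m mv =>
    let* v := candidate i j m in
    let* better := perform (if tie i j m then OpLe v mv.2 else OpLt v mv.2) in
    Ret (if better then (m, v) else mv)) (m0, v0) in
  Ret best.1.

Definition first_row (n d : nat) : prog V unit :=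
  for_each (range d n) (fun j =>
    let* _ := OpWriteI (GammaCell 1 j) 1 in
    let* e := OpReadR (SigmaCell 1 j) in
    OpWriteR (RhoCell 1 j) e).

Definition next_rows (tie : nat -> nat -> nat -> bool) (n k d : nat) :
    prog V unit :=
  for_each (range 2 k) (fun i =>
    for_each (range (i * d) n) (fun j =>
      let* m := search tie d i j in
      let* _ := OpWriteI (GammaCell i j) m.+1 in
      let* g := OpReadI (GammaCell i j) in
      let* r := OpReadR (RhoCell i.-1 g.-1) in
      let* e := OpReadR (SigmaCell g j) in
      let* v := OpAdd r e in
      OpWriteR (RhoCell i j) v)).

(* [rev (iota 0 k.-1)] is k - 2, ..., 0, and is empty for k = 1. *)
Definition backtrack (n k : nat) : prog V unit :=
  let* _ := OpWriteI (LCell k) n in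
  let* g := OpReadI (GammaCell k n) in
  let* _ := OpWriteI (LCell k.-1) g in
  for_each (rev (iota 0 k.-1)) (fun m =>
    let* l := OpReadI (LCell m.+1) in
    let* g := OpReadI (GammaCell m.+1 l.-1) in
    OpWriteI (LCell m) g).

(* The output is ([:: l_0; ...; l_k], rho^2_{k,n}). *)
Definition read_output (n k : nat) : prog V (seq nat * V) :=
  let* ls := for_fold (range 0 k) (fun m ls =>
    let* l := OpReadI (LCell m) in Ret (rcons ls l)) [::] in
  let* r := OpReadR (RhoCell k n) in
  Ret (ls, r).

Definition omslr (tie : nat -> nat -> nat -> bool) (n k d : nat) :
    prog V (seq nat * V) :=
  let* _ := sigma_table n in
  let* _ := first_row n d in
  let* _ := next_rows tie n k d in
  let* _ := backtrack n k in
  read_output n k.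

End OMSLR.

Definition omslr_op_count (R : realFieldType)
    (tie : nat -> nat -> nat -> bool) (n k d : nat) (x : n.-tuple R) : nat :=
  op_count (run (omslr R tie n k d) (input_store x)).

Section RunningSums.
Variables (R : realFieldType) (x : nat -> R).

Definition sums_of (a b : nat) : sums R :=
  let S f := \sum_(a <= m < b.+1) f m in
  Sums (S x) (S (fun m => m%:R * x m)) (S (fun m => x m * x m))
       (S (fun m => m%:R)) (S (fun m => m%:R * m%:R)).

Lemma sum_index (a b : nat) : (a <= b)%N ->
  \sum_(a <= m < b.+1) (m%:R : R) = (b - a + 1)%:R * tbar R a b.
Proof.
rewrite /tbar => /subnK <-; elim: (b - a)%N => [|e IH].
  rewrite add0n big_nat1 subnn add0n mul1r natrD; by field.
rewrite addSn big_nat_recr /= ?IH ?subSn ?addnK ?leq_addl //; last first.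
  by rewrite ltnW // ltnS leq_addl.
by field.
Qed.

Lemma eval_sigma2_correct (a b : nat) (st : store R) : (a <= b)%N ->
  result (run (eval_sigma2 a b (sums_of a b)) st) = sigma2 x a b.
Proof.
rewrite /eval_sigma2 /sigma2 leq_eqVlt; case: eqVneq => [//|_ /= lt_ab].
have N0 : (b - a + 1)%:R != 0 :> R by rewrite pnatr_eq0 addn1.
have M1E := sum_index (ltnW lt_ab).
have NE : \sum_(a <= m < b.+1) (1 : R) = (b - a + 1)%:R.
  by rewrite sumr_const_nat subSn ?addn1 // ltnW.
have den_gt0 : 0 < \sum_(a <= m < b.+1) (m%:R - tbar R a b) ^+ 2.
  rewrite big_nat_recl /=; last exact: ltnW.
  rewrite ltr_pwDl ?sumr_ge0 // => [|i _]; last exact: sqr_ge0.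
  rewrite lt0r sqr_ge0 andbT expf_eq0 /= /tbar natrD.
  have : a%:R < b%:R :> R by rewrite ltr_nat.
  by move=> ?; apply/eqP; lra.
have xbE : xbar x a b = (\sum_(a <= m < b.+1) x m) / (b - a + 1)%:R.
  by rewrite /xbar mulrC.
have betaE : beta x a b =
    (\sum_(a <= m < b.+1) (x m - xbar x a b) * (m%:R - tbar R a b)) /
    (\sum_(a <= m < b.+1) (m%:R - tbar R a b) ^+ 2) by [].
have alE : alpha x a b = xbar x a b - beta x a b * tbar R a b by [].
move: (alpha x a b) alE => al.
move: (beta x a b) betaE => be betaE alE.
move: (xbar x a b) xbE betaE alE => xb xbE.
move: (tbar R a b) M1E den_gt0 => t M1E.
have -> : \sum_(a <= m < b.+1) (m%:R - t) ^+ 2 =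
    \sum_(a <= m < b.+1) m%:R * m%:R - 2 * t * \sum_(a <= m < b.+1) m%:R
    + t * t * \sum_(a <= m < b.+1) 1.
  rewrite !mulr_sumr -sumrB -big_split /=; apply: eq_bigr => m _; ring.
have -> : \sum_(a <= m < b.+1) (x m - xb) * (m%:R - t) =
    \sum_(a <= m < b.+1) m%:R * x m - xb * \sum_(a <= m < b.+1) m%:R
    - t * \sum_(a <= m < b.+1) x m + xb * t * \sum_(a <= m < b.+1) 1.
  rewrite !mulr_sumr -!sumrB -big_split /=; apply: eq_bigr => m _; ring.
have -> : \sum_(a <= m < b.+1) (x m - be * m%:R - al) ^+ 2 =
    \sum_(a <= m < b.+1) x m * x m + be * be * \sum_(a <= m < b.+1) m%:R * m%:R
    + al * al * \sum_(a <= m < b.+1) 1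
    - 2 * be * \sum_(a <= m < b.+1) m%:R * x m
    - 2 * al * \sum_(a <= m < b.+1) x m
    + 2 * al * be * \sum_(a <= m < b.+1) m%:R.
  rewrite !mulr_sumr -!big_split /= -!sumrB -big_split /=.
  apply: eq_bigr => m _; ring.
rewrite NE M1E; move: N0.
move: (b - a + 1)%:R xbE => N xbE N0 den_gt0 betaE ->; rewrite betaE xbE.
move: den_gt0 => /lt0r_neq0.
move: (\sum_(a <= m < b.+1) m%:R * m%:R) => M2.
move: (\sum_(a <= m < b.+1) m%:R * x m) => S2.
move: (\sum_(a <= m < b.+1) x m * x m) => S3.
move: (\sum_(a <= m < b.+1) x m) => S1.
have -> : N * t / N = t by field; rewrite ?N0.
have -> : M2 - 2 * t * (N * t) + t * t * N = M2 - N * t * t by ring.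
move=> D0; field; by rewrite ?D0 ?N0.
Qed.
End RunningSums.

(* Main.v *)
Require Import Defs.
From mathcomp Require Import all_boot all_order all_algebra.
From mathcomp Require Import reals.
From mathcomp Require Import zify.

(** Each phase of the algorithm is a nest of loops whose bodies are
    straight-line programs, so its cost is bounded by the product of the loop
    lengths.  The sigma table costs O(n^2), the first row O(n), each of the
    remaining k - 1 rows O(n^2), since it consists of at most n searches among
    at most n candidates, and backtracking and output cost O(k). *)

Section Cost.
Variable R : realFieldType.

(** The bound is uniform in the initial store, so costs add under [bind] without tracking what the
    first program leaves in memory. *)
Definition cost_le {A : Type} (p : prog R A) (c : nat) : Prop :=
  forall s, op_count (run p s) <= c.

Lemma cost_leW {A : Type} (p : prog R A) (c c' : nat) :
  c <= c' -> cost_le p c -> cost_le p c'.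
Proof. by move=> le_cc' pc s; apply: leq_trans (pc s) le_cc'. Qed.

Lemma op_count_bind {A B : Type} (p : prog R A) (f : A -> prog R B) s :
  op_count (run (bind p f) s) =
  op_count (run p s) + op_count (run (f (result (run p s))) (final (run p s))).
Proof. by elim: p s => [a|T o q IH] s //=; rewrite IH. Qed.

Lemma cost_bind {A B : Type} (p : prog R A) (f : A -> prog R B) (c c' : nat) :
  cost_le p c -> (forall a, cost_le (f a) c') -> cost_le (bind p f) (c + c').
Proof. by move=> pc fc s; rewrite op_count_bind leq_add // ?pc ?fc. Qed.

(** The body is bounded for every loop state, as the state left by earlier iterations is unknown;
    restricting [i] to [r] makes the loop bounds available to nested loops. *)
Lemma cost_for_fold {S : Type} (r : seq nat) (body : nat -> S -> prog R S)
    (s : S) (N c : nat) :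
  size r <= N -> (forall i s', i \in r -> cost_le (body i s') c) ->
  cost_le (for_fold r body s) (N * c).
Proof.
elim: r s N => [|i r IH] s [|N] //= le_rN bc; rewrite mulSn.
apply: cost_bind => [|s']; first by apply: bc; rewrite mem_head.
by apply: IH => // j s'' jr; apply: bc; rewrite inE jr orbT.
Qed.

Lemma cost_for_each (r : seq nat) (body : nat -> prog R unit) (N c : nat) :
  size r <= N -> (forall i, i \in r -> cost_le (body i) c) ->
  cost_le (for_each r body) (N * c).
Proof. by move=> le_rN bc; apply: cost_for_fold => // i _; apply: bc. Qed.

Lemma size_range (a b : nat) : size (range a b) = b.+1 - a.
Proof. exact: size_iota. Qed.

Lemma mem_range (a b i : nat) : (i \in range a b) = (a <= i <= b).
Proof. by rewrite mem_index_iota ltnS. Qed.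

Lemma cost_eval_sigma2 (a b : nat) (s : sums R) :
  cost_le (eval_sigma2 a b s) 14.
Proof. by rewrite /eval_sigma2; case: (a == b). Qed.

Lemma cost_sigma_table (n : nat) :
  cost_le (sigma_table R n) (n * (1 + n * 25)).
Proof.
apply: cost_for_each => [|a]; first by rewrite size_range subn1.
rewrite mem_range => /andP[a_gt0 _].
(* The added 0 is the cost of the final [Ret tt]. *)
apply: (@cost_bind _ _ _ _ 1) => // s0; rewrite -[n * 25]addn0.
apply: cost_bind => //.
apply: cost_for_fold => [|b s _]; first by rewrite size_range; lia.
(* 25 = 10 for updating the sums, 14 for evaluating the error, 1 for the write. *)
apply: (@cost_bind _ _ _ _ 10 15) => // s'.
by apply: (@cost_bind _ _ _ _ 14 1) => [|e //]; apply: cost_eval_sigma2.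
Qed.

Lemma cost_first_row (n d : nat) : 0 < d -> cost_le (first_row R n d) (n * 3).
Proof.
by move=> d_gt0; apply: cost_for_each => //; rewrite size_range; lia.
Qed.

(** A candidate costs two reads and an addition. The first one gives the 3; each of the at most [j]
    others adds one comparison, strict or not according to [tie]. *)
Lemma cost_search (tie : nat -> nat -> nat -> bool) (d i j : nat) :
  cost_le (search R tie d i j) (3 + j * 4).
Proof.
apply: (@cost_bind _ _ _ _ 3) => // v0; rewrite -[j * 4]addn0.
apply: cost_bind => //.
apply: cost_for_fold => [|m mv _]; first by rewrite size_range; lia.
by apply: (@cost_bind _ _ _ _ 3 1) => // v; case: (tie i j m).
Qed.

Lemma cost_next_rows (tie : nat -> nat -> nat -> bool) (n k d : nat) :
  0 < d -> cost_le (next_rows R tie n k d) (k.-1 * (n * (9 + n * 4))).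
Proof.
move=> d_gt0; apply: cost_for_each => [|i]; first by rewrite size_range; lia.
rewrite mem_range => /andP[i_gt1 _].
(* The row has at most [n] entries because [i * d] is positive. *)
apply: cost_for_each => [|j]; first by rewrite size_range; nia.
rewrite mem_range => /andP[_ le_jn].
(* After the search, six operations store gamma and compute and store rho; [j <= n] then gives the
   bound. *)
apply: (@cost_leW _ _ (3 + j * 4 + 6)); first by lia.
by apply: cost_bind => [|m //]; apply: cost_search.
Qed.

Lemma cost_backtrack (n k : nat) : cost_le (backtrack R n k) (3 + k.-1 * 3).
Proof.
apply: (@cost_bind _ _ _ _ 1 (2 + k.-1 * 3)) => // _.
apply: (@cost_bind _ _ _ _ 1 (1 + k.-1 * 3)) => // g.
apply: (@cost_bind _ _ _ _ 1) => // _.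
by apply: cost_for_each; rewrite ?size_rev ?size_iota.
Qed.

Lemma cost_read_output (n k : nat) : cost_le (read_output R n k) (k.+1 * 1 + 1).
Proof.
apply: cost_bind => //.
by apply: cost_for_fold; rewrite ?size_range.
Qed.

Lemma cost_omslr (tie : nat -> nat -> nat -> bool) (n k d : nat) :
  0 < d -> cost_le (omslr R tie n k d)
    (n * (1 + n * 25) + (n * 3 + (k.-1 * (n * (9 + n * 4))
      + (3 + k.-1 * 3 + (k.+1 * 1 + 1))))).
Proof.
move=> d_gt0.
apply: cost_bind => [|_]; first exact: cost_sigma_table.
apply: cost_bind => [|_]; first exact: cost_first_row.
apply: cost_bind => [|_]; first exact: cost_next_rows.
apply: cost_bind => [|_]; first exact: cost_backtrack.
exact: cost_read_output.
Qed.

End Cost.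

Theorem theorem2 :
  exists C : nat,
    forall (R : realType) (tie : nat -> nat -> nat -> bool) (n k d : nat)
      (x : n.-tuple R),
      (1 <= n)%N -> (1 <= k)%N -> (1 <= d)%N -> (k * d <= n)%N ->
      (omslr_op_count tie k d x <= C * k * n ^ 2)%N.
Proof.
(* A generous constant: the estimates below already give 35. *)
exists 50 => R tie n k d x n_gt0 k_gt0 d_gt0 _.
apply: leq_trans (cost_omslr _ tie n k d d_gt0 (input_store x)) _.
case: k k_gt0 => // k _; rewrite -mulnn /=.
(* With [k] now standing for the former [k.-1], each lower-order monomial is dominated by [n * n] or
   [k * (n * n)]. *)
have le_n_nn : n <= n * n by rewrite leq_pmulr.
have le_kn : k * n <= k * (n * n) by rewrite leq_mul2l le_n_nn orbT.
have le_k : k <= k * (n * n) by rewrite leq_pmulr // muln_gt0 n_gt0.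
by nia.
Qed.
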